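(* Let $D(n)$ be the largest number such that in every arrangement of $n$ lines in the plane in which no six lines are tangent to a common conic, there are $D(n)$ lines of the arrangement such that the triangles formed by triples of these lines have pairwise distinct areas. Then $n^{1/5}<D(n)$.
   Context: A triangle formed by three lines is the triangle bounded by them (three pairwise non-parallel lines; if concurrent the triangle is degenerate of area $0$). The general position hypothesis is that no six lines of the arrangement are tangent to a common (possibly degenerate) conic; in the paper's convention this in particular excludes six lines through a common point and six pairwise parallel lines.
   Formalization: The inequality is stated for n ≥ 2, since for n = 0 and n = 1 one has D(n) = n and the strict inequality n^{1/5} < D(n) fails. *)

(* Defs.v *)
From mathcomp Require Import all_boot all_order all_algebra.
From mathcomp Require Import all_classical all_reals all_analysis.

Set Implicit Arguments.
Unset Strict Implicit.
Unset Printing Implicit Defensive.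

Import Order.TTheory GRing.Theory Num.Theory.

Local Open Scope classical_set_scope.
Local Open Scope ring_scope.

(* Homogeneous coordinates: the affine point (x, y) is (x : y : 1); the row
   vector u = (a, b, c) is the line a x + b y + c z = 0. *)
Definition homog (R : realType) (p : R * R) : 'rV[R]_3 :=
  \row_(i < 3) [:: p.1; p.2; 1]`_i.

Definition incident (R : realType) (P u : 'rV[R]_3) : Prop := P *m u^T = 0.

Definition line_of (R : realType) (u : 'rV[R]_3) : set (R * R) :=
  [set p | incident (homog p) u].

(* Neither zero nor the line at infinity. *)
Definition affine_coords (R : realType) (u : 'rV[R]_3) : Prop :=
  u 0 0 != 0 \/ u 0 1 != 0.

Definition is_line (R : realType) (l : set (R * R)) : Prop :=
  exists2 u : 'rV[R]_3, affine_coords u & l = line_of u.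

(* The projective conic X Q X^T = 0.  Rank 3 is a nondegenerate conic, rank 2 a
   pair of lines (real or complex conjugate).  Rank 1, a double line, is left
   out: every line of the plane meets it with multiplicity two. *)
Definition is_conic (R : realType) (Q : 'M[R]_3) : Prop :=
  Q^T = Q /\ (2 <= \rank Q)%N.

(* [P] is the point of contact: it lies on l, and l lies in its polar.  [P] may
   be at infinity, so the asymptotes of a hyperbola are tangent to it.  For a
   rank 2 conic the tangents are the lines through the common point of its two
   components: a pencil of concurrent lines, or of parallel lines when this
   point is at infinity. *)
Definition tangent (R : realType) (Q : 'M[R]_3) (l : set (R * R)) : Prop :=
  exists u P : 'rV[R]_3,
    [/\ affine_coords u, l = line_of u, P != 0, incident P u &
        forall X : 'rV[R]_3, incident X u -> X *m Q *m P^T = 0].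

Definition line_arrangement (R : realType) (n : nat)
    (L : 'I_n -> set (R * R)) : Prop :=
  injective L /\ forall i, is_line (L i).

Definition no_six_cotangent (R : realType) (n : nat)
    (L : 'I_n -> set (R * R)) : Prop :=
  forall S : {set 'I_n}, #|S| = 6%N ->
    ~ exists2 Q : 'M[R]_3, is_conic Q & forall i, i \in S -> tangent Q (L i).

Definition area (R : realType) (p q r : R * R) : R :=
  `|(q.1 - p.1) * (r.2 - p.2) - (r.1 - p.1) * (q.2 - p.2)| / 2.

(* The three lines form a triangle, of area [a].  Two lines meet in exactly one
   point iff they are not parallel, so the singleton conditions make the lines
   pairwise non-parallel, hence distinct; concurrent lines are allowed and give
   p = q = r and a = 0. *)
Definition triangle_area (R : realType) (l1 l2 l3 : set (R * R)) (a : R) : Prop :=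
  exists p q r : R * R,
    [/\ l2 `&` l3 = [set p], l1 `&` l3 = [set q], l1 `&` l2 = [set r] &
        a = area p q r].

Definition distinct_areas (R : realType) (n : nat) (L : 'I_n -> set (R * R))
    (S : {set 'I_n}) : Prop :=
  forall (i j k i' j' k' : 'I_n) (a a' : R),
    i \in S -> j \in S -> k \in S -> i' \in S -> j' \in S -> k' \in S ->
    triangle_area (L i) (L j) (L k) a ->
    triangle_area (L i') (L j') (L k') a' ->
    [set i; j; k]%SET != [set i'; j'; k']%SET :> {set 'I_n} -> a != a'.

Definition guaranteed (R : realType) (n d : nat) : Prop :=
  forall L : 'I_n -> set (R * R),
    line_arrangement L -> no_six_cotangent L ->
    exists S : {set 'I_n}, #|S| = d /\ distinct_areas L S.

Definition is_largest (A : set nat) (d : nat) : Prop :=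
  A d /\ forall d', A d' -> (d' <= d)%N.

(* The largest guaranteed number; the default value 0 would only be taken if
   there were none. *)
Definition D (R : realType) (n : nat) : nat :=
  xget 0%N [set d | is_largest [set d' | guaranteed R n d'] d].

(* Main.v *)
Require Import Defs.
From mathcomp Require Import all_boot all_order all_algebra.
From mathcomp Require Import all_classical all_reals all_analysis.
(* Imported again: names such as [setP] and [subsetP] are meant for finite sets,
   not for classical ones. *)
From mathcomp Require Import fintype finset.
From mathcomp Require Import zify ring lra.

(** Write a line as [u = (a, b, c)], let [[u, v]] be the determinant of the
    first two coordinates and normalise [u] so that [[u, v] >= 0] orders the
    lines by slope.  Lines [a], [b], [l] bound a triangle of area
    [det(a, b, l)^2 / (2 |[a, b] [b, l] [a, l]|)].  For fixed [a], [b], a fixed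
    area and a fixed sign of [[a, l] [b, l]], the line [l] is therefore tangent
    to one conic having [a] and [b] as asymptotes (the pencil through the common
    point of [a] and [b] when the area is 0).  As [a] and [b] are tangent to it
    too, there are at most three such [l].

    Fix a triple [T].  A triple [p < q < r] of the same area is seen from its
    two pairs [p < q] and [q < r] with the third line outside the pair, so at
    most [3/2 binom(n-3, 2)] triples disjoint from [T] have the area of [T]; the
    triples meeting [T] are of lower order.  Hence a random [m]-subset contains
    on average at most about [m^6 / (16 n)] pairs of triples of equal area.
    Removing one line for each pair leaves more than [n^(1/5)] lines when [m] is
    about [6/5 n^(1/5)].

    That the maximum defining [D] exists needs some arrangement in general
    position: the lines [(1, t, t^3)] with [t = 1, ..., n].  On them a dual
    conic is a polynomial in [t] of degree at most 6 without [t^5], so six roots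
    would have sum 0 and cannot all be positive. *)

Set Implicit Arguments.
Unset Strict Implicit.
Unset Printing Implicit Defensive.

Import Order.TTheory GRing.Theory Num.Theory.
Local Open Scope ring_scope.

Section DoubleCounting.
Local Open Scope nat_scope.

Lemma double_counting (I J : finType) (A : {set I}) (B : {set J})
    (r : I -> pred J) (p q : nat) :
  {in A, forall i, p <= #|[set j in B | r i j]|} ->
  {in B, forall j, #|[set i in A | r i j]| <= q} ->
  p * #|A| <= q * #|B|.
Proof.
move=> pA Bq; rewrite mulnC -sum_nat_const [leqRHS]mulnC -sum_nat_const.
apply: (@leq_trans (\sum_(i in A) \sum_(j in B) r i j)).
  apply: leq_sum => i /pA /leq_trans; apply.
  by rewrite -sum1dep_card big_mkcondr.
rewrite exchange_big; apply: leq_sum => j /Bq; apply: leq_trans.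
by rewrite -sum1dep_card big_mkcondr.
Qed.

Variable V : finType.
Implicit Types (A P T : {set V}) (F G : {set {set V}}).

Lemma cards3P (a b c : V) :
  reflect [/\ a != b, a != c & b != c] (#|[set a; b; c]| == 3).
Proof.
rewrite -setUA cardsU1 cards2 !inE negb_or.
apply: (iffP idP) => [|[-> -> ->]//].
by case: (a == b); case: (a == c); case: (b == c).
Qed.

Lemma double_counting_facets F G (ext : {set V} -> pred V) (p q : nat) :
  {in G, forall A, p <= #|[set x in A | (A :\ x \in F) && ext (A :\ x) x]|} ->
  {in F, forall P, #|[set x | (x |: P \in G) && ext P x]| <= q} ->
  p * #|G| <= q * #|F|.
Proof.
move=> pG Fq; pose facet A P := [exists x in A, (P == A :\ x) && ext P x].
apply: (double_counting (r := facet)) => [A AG|P PF].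
  apply: leq_trans (pG A AG) _; rewrite -(card_in_imset (f := fun x => A :\ x)).
    apply/subset_leq_card/subsetP => _ /imsetP[x + ->].
    rewrite !inE => /and3P[xA -> ext_x] /=.
    by apply/exists_inP; exists x => //; rewrite eqxx.
  move=> x y; rewrite inE => /andP[xA _] _ /setP/(_ x).
  by rewrite !inE eqxx xA andbT; case: eqVneq.
apply: leq_trans (Fq P PF).
apply: leq_trans (leq_imset_card (fun x => x |: P) _).
apply/subset_leq_card/subsetP => A; rewrite inE => /andP[AG].
case/exists_inP => x xA /andP[/eqP eP ext_x].
by apply/imsetP; exists x; rewrite ?inE eP setD1K // AG -eP.
Qed.

Lemma leq_card_draws_meeting T (k j : nat) :
  #|[set P : {set V} | (#|P| == k) && (#|P :&: T| == j)]|
    <= 'C(#|T|, j) * 'C(#|~: T|, k - j).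
Proof.
rewrite -!cards_draws -cardsX.
pose join (AB : {set V} * {set V}) := AB.1 :|: AB.2.
apply: leq_trans (leq_imset_card join _).
apply/subset_leq_card/subsetP => P; rewrite inE => /andP[/eqP cP /eqP cPT].
apply/imsetP; exists (P :&: T, P :\: T); last by rewrite /join /= setID.
by rewrite !inE /= subsetIr cPT eqxx setDE subsetIr -setDE cardsD cP cPT eqxx.
Qed.

Definition outer (le : rel V) P : pred V :=
  fun x => [forall a in P, le a x] || [forall a in P, le x a].

(* The two extremes are the ends of a sorted enumeration. *)
Lemma card_outer_gt1 (le : rel V) T :
  total le -> transitive le -> 1 < #|T| ->
  1 < #|[set x in T | outer le (T :\ x) x]|.
Proof.
move=> le_total le_trans T_gt1.
have s_uniq : uniq (sort le (enum T)) by rewrite sort_uniq enum_uniq.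
have s_sorted : sorted le (sort le (enum T)) by rewrite sort_sorted.
have mem_s : sort le (enum T) =i T by move=> x; rewrite mem_sort mem_enum.
have [x [s [y sE]]] : exists x s y, sort le (enum T) = x :: rcons s y.
  have : size (sort le (enum T)) = #|T| by rewrite size_sort -cardE.
  case: (sort le _) => [|x s] size_s; first by rewrite -size_s in T_gt1.
  case/lastP: s size_s => [|s y] size_s; first by rewrite -size_s in T_gt1.
  by exists x, s, y.
move: s_uniq s_sorted mem_s; rewrite {}sE sorted_pairwise // -rcons_cons.
rewrite pairwise_rcons rcons_uniq => /andP[y_new _] /andP[/allP le_y].
rewrite pairwise_cons => /andP[/allP x_le _] mem_T.
have xy : x != y by apply: contraNneq y_new => <-; rewrite mem_head.
apply: (@leq_trans #|[set x; y]|); first by rewrite cards2 xy.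
apply/subset_leq_card/subsetP => z; rewrite in_set2 inE -!mem_T.
case/orP=> /eqP->; rewrite ?mem_rcons !inE eqxx ?orbT /=; apply/orP.
- right; apply/forall_inP => a; rewrite !inE -mem_T mem_rcons !inE.
  by case: eqVneq => //= _ /orP[/eqP->|/x_le//]; apply: le_y; rewrite mem_head.
- left; apply/forall_inP => a; rewrite !inE -mem_T mem_rcons !inE.
  by case: eqVneq => //= _ a_xs; apply: le_y; rewrite inE.
Qed.

End DoubleCounting.

Section RandomDraws.
Variable V : finType.
Implicit Types (S U : {set V}) (F : {set {set V}}).

Lemma exists_le_mean (R : realDomainType) (I : finType) (A : {set I})
    (f : I -> R) :
  A != set0 -> exists2 i, i \in A & #|A|%:R * f i <= \sum_(i in A) f i.
Proof.
case/set0Pn => i0 i0A; case: (arg_minP f i0A) => i iA f_min; exists i => //.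
by rewrite mulr_natl -sumr_const; apply: ler_sum.
Qed.

Lemma exists_subset_card S (k : nat) :
  (k <= #|S|)%N -> exists2 A : {set V}, A \subset S & #|A| = k.
Proof.
move=> /card_geqP[s [us <- sS]]; exists [set x in s].
  by apply/subsetP => x; rewrite inE => /sS.
by rewrite cardsE; apply/card_uniqP.
Qed.

Lemma mul_bin_ffact (n m j : nat) :
  (j <= m)%N -> ('C(n - j, m - j) * n ^_ j = 'C(n, m) * m ^_ j)%N.
Proof.
elim: j n m => [|j IHj] n [|m] //; first by rewrite !subn0.
  by rewrite !ffactn0 !muln1 !subn0.
case: n => [|n] jm; first by rewrite !ffact0n !muln0 bin0n.
rewrite !subSS !ffactSS mulnCA IHj // mulnA mul_bin_diag.
by rewrite [in RHS]mulnCA mulnA.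
Qed.

Lemma card_draws_superset U (m : nat) :
  (#|[set S : {set V} | (#|S| == m) && (U \subset S)]| * #|V| ^_ #|U|
    = 'C(#|V|, m) * m ^_ #|U|)%N.
Proof.
have [Um|mU] := leqP #|U| m; last first.
  rewrite (ffact_small mU) muln0 (_ : [set _ | _] = set0) ?cards0 //.
  apply/setP => S; rewrite !inE; apply: contraTF mU.
  by case/andP=> /eqP <- /subset_leq_card; rewrite -leqNgt.
rewrite -mul_bin_ffact //; congr muln.
rewrite -[in RHS](cardsC U) addKn -cards_draws.
rewrite -(card_in_imset (f := fun S => S :\: U)); last first.
  move=> S S'; rewrite !inE => /andP[_ /setIidPr eS] /andP[_ /setIidPr eS'] eD.
  by rewrite -(setID S U) -(setID S' U) eD eS eS'.
congr #|pred_of_set _|; apply/setP => A; rewrite inE.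
apply/imsetP/andP => [[S + ->]|[AU /eqP cA]].
  rewrite inE => /andP[/eqP cS US].
  by rewrite setDE subsetIr -setDE cardsD cS (setIidPr US).
have disjAU : A :&: U = set0 by apply/eqP; rewrite setI_eq0 disjoints_subset.
exists (A :|: U); last by rewrite setDUl setDv setU0 setDE; apply/esym/setIidPl.
by rewrite inE subsetUr cardsU disjAU cards0 subn0 cA subnK ?eqxx.
Qed.

(* The probability that a random [m]-subset of [n] points contains [j] given
   points. *)
Definition draw_prob (n m j : nat) : rat := (m ^_ j)%:R / (n ^_ j)%:R.

Lemma exists_draw_few_subsets F (m : nat) :
  (m <= #|V|)%N ->
  exists2 S : {set V}, #|S| = m &
    #|F ::&: S|%:R <= \sum_(U in F) draw_prob #|V| m #|U|.
Proof.
move=> mV; set draws := [set S : {set V} | #|S| == m].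
have draws_gt0 : (0 < #|draws|)%N by rewrite card_draws bin_gt0.
have [|S] := @exists_le_mean rat _ draws (fun S => #|F ::&: S|%:R).
  by rewrite -card_gt0.
rewrite inE => /eqP cS le_S; exists S => //.
rewrite -(ler_pM2l (_ : 0 < #|draws|%:R)) ?ltr0n //; apply: le_trans le_S _.
rewrite -natr_sum; under eq_bigr do rewrite /ssetI -sum1dep_card big_mkcondr.
rewrite exchange_big natr_sum mulr_sumr; apply: ler_sum => U _.
rewrite -big_mkcondr sum1dep_card /draw_prob mulrA.
rewrite ler_pdivlMr ?ltr0n ?ffact_gt0 ?max_card // -!natrM card_draws.
rewrite -card_draws_superset ler_nat leq_mul2r; apply/orP; right.
by apply/subset_leq_card/subsetP => A; rewrite !inE.
Qed.

Lemma exists_free_subset F S :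
  set0 \notin F ->
  exists2 S' : {set V}, {in F, forall U, ~~ (U \subset S')} &
    (#|S| <= #|S'| + #|F ::&: S|)%N.
Proof.
move=> F0; set FS := F ::&: S.
pose deleted : {set V} :=
  [set x | Some x \in [set [pick x in U] | U : {set V} in FS]].
exists (S :\: deleted) => [U UF|].
  have [US|] := boolP (U \subset S); last first.
    by apply: contraNN => /subset_trans; apply; apply: subsetDl.
  have [x xU pick_x] : exists2 x, x \in U & [pick x in U] = Some x.
    case: pickP => [x xU|/eq_card0/cards0_eq U0]; first by exists x.
    by rewrite -U0 UF in F0.
  apply/subsetPn; exists x => //; rewrite !inE -pick_x imset_f //.
  by rewrite inE UF.
rewrite -(cardsID deleted S) addnC leq_add2l.
apply: leq_trans (leq_imset_card (fun U : {set V} => [pick x in U]) FS).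
rewrite -(card_imset _ Some_inj).
apply/subset_leq_card/subsetP => _ /imsetP[x + ->].
by rewrite !inE => /andP[_].
Qed.

(* Draw an [m]-subset at random and delete one point from each member of [F]
   that it contains. *)
Lemma exists_large_free_subset F (m : nat) :
  (m <= #|V|)%N -> set0 \notin F ->
  exists2 S : {set V}, {in F, forall U, ~~ (U \subset S)} &
    m%:R - \sum_(U in F) draw_prob #|V| m #|U| <= #|S|%:R.
Proof.
move=> /(exists_draw_few_subsets F)[S0 <- few].
move=> /(exists_free_subset S0)[S SF le_S].
exists S => //; rewrite lerBlDr; apply: le_trans (lerD (lexx _) few).
by rewrite -natrD ler_nat.
Qed.

End RandomDraws.

Section ConflictingSets.
Variables (V : finType) (e : rel {set V}).
Implicit Types (S T U : {set V}).

Definition independent S := forall T T', e T T' -> ~~ (T :|: T' \subset S).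

Lemma independentS S S' : S' \subset S -> independent S -> independent S'.
Proof.
by move=> S'S indS T T' /indS; apply: contraNN => /subset_trans; apply.
Qed.

Definition conflicts : {set {set V}} :=
  [set TT.1 :|: TT.2 | TT in [set TT : {set V} * {set V} | e TT.1 TT.2]].

Lemma sum_conflicts (R : numDomainType) (w : {set V} -> R) :
  symmetric e -> irreflexive e -> (forall U, 0 <= w U) ->
  2 * (\sum_(U in conflicts) w U) <= \sum_T \sum_(T' | e T T') w (T :|: T').
Proof.
move=> e_sym e_irr w_ge0; set pairs := [set TT | e TT.1 TT.2].
rewrite pair_big_dep (eq_bigl [in pairs]) => [/=|TT]; last by rewrite inE.
rewrite (partition_big_imset (fun TT => TT.1 :|: TT.2)) mulr_sumr.
apply: ler_sum => _ /imsetP[[T T'] + ->]; rewrite inE /= => eTT'.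
have neq : (T', T) != (T, T').
  by rewrite xpair_eqE; apply: contraTN eTT' => /andP[/eqP -> _]; rewrite e_irr.
rewrite (bigD1 (T, T')) ?inE /= ?eTT' ?eqxx // (bigD1 (T', T)) /=; last first.
  by rewrite inE /= e_sym eTT' setUC eqxx neq.
rewrite [T' :|: T]setUC addrA -mulr2n mulr_natl lerDl.
by apply: sumr_ge0.
Qed.

End ConflictingSets.

(* The choice [m ~ 6N/5] makes [m - m^6 / (16 N^5)] exceed [N]: indeed
   [6/5 - (6/5)^6 / 16 > 1]. *)
Lemma exists_sample_size (N : nat) :
  (3 <= N)%N ->
  exists m, [/\ N < m, m <= N ^ 5 &
    m ^_ 6 + 12 * m ^_ 5 + 24 * m ^_ 4 < 16 * (N ^ 5 - 5) * (m - N)]%N.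
Proof.
move=> N3; have [N5|N5] := ltnP N 5.
  exists N.+1; rewrite !ffactnSr ffactn0 !expnS expn0.
  by have [->|->] : N = 3%N \/ N = 4%N by lia.
have [t [r [-> r5]]] : exists t r, N = (5 * t + 5 + r)%N /\ (r < 5)%N.
  exists (N %/ 5 - 1)%N, (N %% 5)%N; have := divn_eq N 5.
  by have := ltn_pmod N (isT : 0 < 5)%N; lia.
exists (6 * t + 6 + r + (0 < r))%N; rewrite !ffactnSr ffactn0 !expnS expn0.
by move: r5; case: r => [|[|[|[|[|]]]]] // _ /=; split; lia.
Qed.

Section TripleSystems.
Variables (V : finType) (leV : rel V) (e : rel {set V}).
Hypotheses (leV_total : total leV) (leV_trans : transitive leV).
Implicit Types T : {set V}.

Hypotheses (e_sym : symmetric e) (e_irr : irreflexive e).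
Hypothesis e_card3 : forall T T', e T T' -> #|T'| = 3%N.
Hypothesis e_link : forall (T P : {set V}) (side : bool), #|P| = 2%N ->
  (#|[set x | e T (x |: P) && (outer leV P x == side)]| <= 3)%N.

Definition overlap T (j : nat) : {set {set V}} :=
  [set T' | e T T' & #|T' :&: T| == j].

Lemma card_overlap_disjoint T :
  #|T| = 3%N -> (2 * #|overlap T 0| <= 3 * 'C(#|V| - 3, 2))%N.
Proof.
move=> T3; rewrite -{2}T3 -(cardsC T) addKn -cards_draws.
apply: (double_counting_facets (ext := outer leV)) => [T'|P].
  rewrite inE cards_eq0 => /andP[/e_card3 T'3 /eqP T'T].
  apply: leq_trans (card_outer_gt1 leV_total leV_trans (_ : 1 < #|T'|)%N) _.
    by rewrite T'3.
  apply/subset_leq_card/subsetP => x; rewrite !inE => /andP[xT' ->].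
  have -> : #|T' :\ x| = 2 by move: T'3; rewrite (cardsD1 x) xT' => -[].
  rewrite xT' eqxx !andbT; apply: subset_trans (subsetDl _ _) _.
  by rewrite -disjoints_subset -setI_eq0 T'T.
rewrite inE => /andP[_ /eqP P2]; apply: leq_trans (e_link T true P2).
apply/subset_leq_card/subsetP => x; rewrite !inE => /andP[/andP[-> _] ->].
by rewrite eqxx.
Qed.

Lemma card_overlap T (j : nat) :
  #|T| = 3%N ->
  ((3 - j) * #|overlap T j| <= 6 * ('C(3, j) * 'C(#|V| - 3, 2 - j)))%N.
Proof.
move=> T3; rewrite -[X in 'C(X, j)]T3 -[X in 'C(_ - X, _)]T3 -(cardsC T) addKn.
apply: leq_trans (leq_mul (leqnn 6) (leq_card_draws_meeting T 2 j)).
apply: (double_counting_facets (ext := fun _ _ => true)) => [T'|P].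
  rewrite inE => /andP[/e_card3 T'3 /eqP T'T].
  rewrite -T'T -T'3 -cardsD; apply/subset_leq_card/subsetP => x.
  rewrite !inE andbT => /andP[xT xT'].
  have -> : #|T' :\ x| = 2 by move: T'3; rewrite (cardsD1 x) xT' => -[].
  rewrite xT' /=; apply/eqP; congr #|pred_of_set _|; apply/setP => y.
  by rewrite !inE; case: eqVneq => // ->; rewrite (negbTE xT) !andbF.
rewrite inE => /andP[/eqP P2 _].
apply: leq_trans (leq_add (e_link T true P2) (e_link T false P2)).
apply: leq_trans (leq_card_setU _ _); apply/subset_leq_card/subsetP => x.
by rewrite !inE => /andP[/andP[-> _] _]; case: outer.
Qed.

Lemma sum_overlap (R : pzSemiRingType) T (w : nat -> R) :
  #|T| = 3%N ->
  \sum_(T' | e T T') w #|T :|: T'| =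
  \sum_(j < 3) #|overlap T j|%:R * w (6 - j)%N.
Proof.
move=> T3.
have meet_lt3 T' : e T T' -> (#|T' :&: T| < 3)%N.
  move=> eTT'; rewrite ltn_neqAle -{2}T3 subset_leq_card ?subsetIr // andbT.
  apply: contraTneq (eTT') => I3; rewrite (_ : T' = T) ?e_irr //.
  apply/eqP; rewrite eqEcard T3 (e_card3 eTT') leqnn andbT; apply/setIidPl/eqP.
  by rewrite eqEcard subsetIl I3 (e_card3 eTT').
rewrite (partition_big (fun T' => inord #|T' :&: T| : 'I_3) predT) //=.
apply: eq_bigr => j _; rewrite mulr_natl -sumr_const.
apply: eq_big => [T'|T' /andP[eTT' /eqP <-]].
  rewrite inE; case: (boolP (e T T')) => //= eTT'.
  by rewrite -val_eqE /= inordK ?meet_lt3.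
by rewrite inordK ?meet_lt3 // cardsU T3 (e_card3 eTT') setIC.
Qed.

Lemma card_overlap_ffact T (j : 'I_3) :
  #|T| = 3%N ->
  (8 * (#|V| - 5) * ('C(#|V|, 3) * #|overlap T j|)
    <= nth 0 [:: 1; 12; 24] j * #|V| ^_ (6 - j))%N.
Proof.
move=> T3; set n := #|V|.
have ffact3 : (n ^_ 3 = 6 * 'C(n, 3))%N by rewrite -bin_ffact mulnC.
have ffact2 : (2 * 'C(n - 3, 2) = (n - 3) * (n - 4))%N.
  by rewrite mulnC (bin_ffact _ 2) !ffactnSr ffactn0 mul1n subn0 -subnDA.
have n54 : (n - 5 <= n - 4)%N by exact: leq_sub2l.
have n53 : (n - 5 <= n - 3)%N by exact: leq_sub2l.
case: j => [[|[|[|//]]] j3] /=; rewrite ?(ffactnSr n 5) ?(ffactnSr n 4);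
  rewrite (ffactnSr n 3) ffact3.
- have card_disj := leq_mul (leqnn 2) (card_overlap_disjoint T3).
  rewrite [(2 * (3 * _))%N]mulnCA ffact2 in card_disj.
  have := leq_mul (leqnn ('C(n, 3) * (n - 5))) card_disj.
  by move: 'C(n, 3) #|_| (n - 3)%N (n - 4)%N (n - 5)%N => c x q r s; lia.
- have card_once : (2 * #|overlap T 1| <= 18 * (n - 3))%N.
    by have := card_overlap 1 T3; rewrite !bin1 mulnA.
  have := leq_mul (leqnn 'C(n, 3)) (leq_mul n54 card_once).
  by move: 'C(n, 3) #|_| (n - 3)%N (n - 4)%N (n - 5)%N => c x q r s; lia.
- have card_twice : (#|overlap T 2| <= 18)%N.
    by have := card_overlap 2 T3; rewrite bin0 mul1n.
  have := leq_mul (leqnn 'C(n, 3)) (leq_mul n53 card_twice).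
  by move: 'C(n, 3) #|_| (n - 3)%N (n - 4)%N (n - 5)%N => c x q r s; lia.
Qed.

Lemma sum_draw_prob_overlap T (m : nat) :
  (5 < #|V|)%N -> #|T| = 3%N ->
  (8 * (#|V| - 5) * 'C(#|V|, 3))%:R *
    (\sum_(T' | e T T') draw_prob #|V| m #|T :|: T'|) <=
  (m ^_ 6 + 12 * m ^_ 5 + 24 * m ^_ 4)%:R.
Proof.
move=> V5 T3; rewrite (sum_overlap (draw_prob #|V| m)) // mulr_sumr.
apply: (@le_trans _ _ (\sum_(j < 3)
    (nth 0 [:: 1; 12; 24] j * m ^_ (6 - j))%N%:R)); last first.
  by rewrite !big_ord_recl big_ord0 addr0 -!natrD ler_nat /= mul1n addnA.
apply: ler_sum => j _; rewrite /draw_prob !mulrA.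
rewrite ler_pdivrMr; last first.
  by rewrite ltr0n ffact_gt0 (leq_trans (leq_subr _ _)).
rewrite -!natrM ler_nat [X in (_ <= X)%N]mulnAC leq_mul2r -mulnA.
by rewrite card_overlap_ffact ?orbT.
Qed.

Lemma sum_draw_prob_conflicts (m : nat) :
  (5 < #|V|)%N ->
  \sum_(U in conflicts e) draw_prob #|V| m #|U| <=
  (m ^_ 6 + 12 * m ^_ 5 + 24 * m ^_ 4)%:R / (16 * (#|V| - 5))%:R.
Proof.
move=> V5; set total := (_ + _ + _)%N.
pose w (U : {set V}) := draw_prob #|V| m #|U|.
have triples_gt0 : 0 < 'C(#|V|, 3)%:R :> rat.
  by rewrite ltr0n bin_gt0 (leq_trans _ V5).
rewrite ler_pdivlMr ?ltr0n ?muln_gt0 ?subn_gt0 // -(ler_pM2l triples_gt0).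
pose c : rat := (8 * (#|V| - 5) * 'C(#|V|, 3))%:R.
rewrite [leLHS](_ : _ = c * (2 * \sum_(U in conflicts e) w U)); last first.
  by rewrite /c /w !natrM; ring.
apply: le_trans (ler_wpM2l _ (sum_conflicts e_sym e_irr _)) _ => // [U|].
  by rewrite divr_ge0.
rewrite (bigID (fun T => #|T| == 3%N)) /=.
rewrite [X in _ + X]big1 => [|T nT3]; last first.
  by rewrite big1 // => T'; rewrite e_sym => /e_card3 T3; rewrite T3 in nT3.
have -> : 'C(#|V|, 3)%:R * total%:R =
    \sum_(T : {set V} | #|T| == 3%N) total%:R :> rat.
  by rewrite sumr_const -cardsE card_draws mulr_natl.
rewrite addr0 mulr_sumr; apply: ler_sum => T /eqP T3.
exact: sum_draw_prob_overlap.
Qed.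

Lemma independent_of_card_le3 (S : {set V}) : (#|S| <= 3)%N -> independent e S.
Proof.
move=> S3 T T' eTT'; apply/negP; rewrite subUset => /andP[TS T'S].
have T3 : #|T| = 3%N by apply: (e_card3 (T := T')); rewrite e_sym.
have eqS (A : {set V}) : A \subset S -> #|A| = 3%N -> A = S.
  by move=> AS A3; apply/eqP; rewrite eqEcard AS A3.
by have := eTT'; rewrite (eqS T) // (eqS T') ?(e_card3 eTT') // e_irr.
Qed.

Lemma exists_independent_set (N : nat) :
  (N < #|V|)%N -> (N ^ 5 <= #|V|)%N ->
  exists2 S : {set V}, #|S| = N.+1 & independent e S.
Proof.
move=> NV N5V; have [N2|N3] := leqP N 2.
  have [|S _ cS] := @exists_subset_card V setT N.+1; first by rewrite cardsT.
  by exists S => //; apply: independent_of_card_le3; rewrite cS.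
have [m [Nm mN5 sparse]] := exists_sample_size N3.
have V5 : (5 < #|V|)%N.
  by apply: leq_trans N5V; apply: (@leq_trans (3 ^ 5)); rewrite ?leq_exp2r.
have conflicts0 : set0 \notin conflicts e.
  apply/imsetP => -[[T T']]; rewrite inE /= => /e_card3 T'3 /esym/eqP.
  by rewrite setU_eq0 => /andP[_ /eqP T'0]; rewrite T'0 cards0 in T'3.
have [S freeS le_S] := exists_large_free_subset (leq_trans mN5 N5V) conflicts0.
have NS : (N < #|S|)%N.
  rewrite -(ltr_nat rat); apply: lt_le_trans le_S; rewrite ltrBrDr -ltrBrDl.
  apply: le_lt_trans (sum_draw_prob_conflicts m V5) _.
  rewrite -natrB; last exact: ltnW.
  rewrite ltr_pdivrMr; last by rewrite ltr0n muln_gt0 subn_gt0.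
  rewrite -natrM ltr_nat [ltnRHS]mulnC; apply: leq_trans sparse _.
  by rewrite leq_mul2r leq_mul2l leq_sub2r ?orbT.
have [A AS cA] := exists_subset_card NS; exists A => //.
apply: independentS AS _ => T T' eTT'; apply: freeS.
by apply/imsetP; exists (T, T'); rewrite ?inE.
Qed.

End TripleSystems.

Lemma ord3P (i : 'I_3) : [\/ i = 0, i = 1 | i = 2].
Proof.
case: i => [[|[|[|//]]] i3]; [constructor 1|constructor 2|constructor 3];
  exact/val_inj.
Qed.

Lemma ord3_pairP (i j : 'I_3) :
  i != j -> exists k : 'I_3,
    i = lift k 0 /\ j = lift k 1 \/ i = lift k 1 /\ j = lift k 0.
Proof.
move=> ij; exists (- (i + j)); move: ij.
case: (ord3P i) => ->; case: (ord3P j) => -> //= _;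
  [left|left|right|left|right|right]; split; exact/val_inj.
Qed.

Lemma sum_ord3 (V : nmodType) (F : 'I_3 -> V) : \sum_i F i = F 0 + F 1 + F 2.
Proof.
rewrite !big_ord_recl big_ord0 addr0 addrA.
by congr (F _ + F _ + F _); apply/val_inj.
Qed.

Section HomogeneousVectors.
Variable R : comNzRingType.
Implicit Types u v w : 'rV[R]_3.

Definition row3 (x y z : R) : 'rV[R]_3 := \row_(i < 3) [:: x; y; z]`_i.

Lemma row3E (x y z : R) :
  ((row3 x y z 0 0 = x) * (row3 x y z 0 1 = y) * (row3 x y z 0 2 = z))%type.
Proof. by rewrite !mxE. Qed.

Lemma row3P u v : u 0 0 = v 0 0 -> u 0 1 = v 0 1 -> u 0 2 = v 0 2 -> u = v.
Proof. by move=> e0 e1 e2; apply/rowP => i; case: (ord3P i) => ->. Qed.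

Definition dot3 u v : R := u 0 0 * v 0 0 + u 0 1 * v 0 1 + u 0 2 * v 0 2.

Lemma mul_row_trE u v : (u *m v^T) 0 0 = dot3 u v.
Proof. by rewrite mxE sum_ord3 !mxE. Qed.

Definition bracket u v : R := u 0 0 * v 0 1 - u 0 1 * v 0 0.

Lemma bracketC u v : bracket v u = - bracket u v.
Proof. by rewrite /bracket; ring. Qed.

Lemma bracketxx u : bracket u u = 0.
Proof. by rewrite /bracket; ring. Qed.

Definition cross u v : 'rV[R]_3 :=
  row3 (u 0 1 * v 0 2 - u 0 2 * v 0 1) (u 0 2 * v 0 0 - u 0 0 * v 0 2)
    (bracket u v).

Definition det3 u v w : R := dot3 u (cross v w).

Lemma det3E u v w :
  det3 u v w = u 0 2 * bracket v w + v 0 2 * bracket w u + w 0 2 * bracket u v.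
Proof. by rewrite /det3 /dot3 !row3E /bracket; ring. Qed.

Lemma det3_swap12 u v w : det3 v u w = - det3 u v w.
Proof. by rewrite !det3E /bracket; ring. Qed.

Lemma det3_swap23 u v w : det3 u w v = - det3 u v w.
Proof. by rewrite !det3E /bracket; ring. Qed.

End HomogeneousVectors.

Section Triangles.
Variable R : realType.
Implicit Types (u v w : 'rV[R]_3) (p : R * R).

Lemma incidentP (P u : 'rV[R]_3) : incident P u <-> dot3 P u = 0.
Proof.
rewrite /incident -mul_row_trE; split=> [->|e]; first by rewrite mxE.
by apply/matrixP => i j; rewrite !ord1 e mxE.
Qed.

Lemma line_ofP u p : line_of u p <-> p.1 * u 0 0 + p.2 * u 0 1 + u 0 2 = 0.
Proof.
rewrite /line_of /= incidentP /dot3 (_ : homog p = row3 p.1 p.2 1) //.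
by rewrite !row3E mul1r.
Qed.

Lemma sqr_norm_affine_gt0 u : affine_coords u -> 0 < u 0 0 ^+ 2 + u 0 1 ^+ 2.
Proof.
case=> u_neq0; [apply: ltr_pwDl|apply: ltr_wpDl];
  by rewrite ?sqr_ge0 // exprn_even_gt0.
Qed.

Lemma line_of_inj u v :
  affine_coords u -> affine_coords v -> line_of u = line_of v ->
  exists2 s, s != 0 & v = s *: u.
Proof.
move=> au av E; set N := u 0 0 ^+ 2 + u 0 1 ^+ 2.
have N0 : N != 0 := lt0r_neq0 (sqr_norm_affine_gt0 au).
have [d u2E] : exists d, u 0 2 = d * N by exists (u 0 2 / N); rewrite divfK.
pose foot (t : R) := (t * u 0 1 - d * u 0 0, - t * u 0 0 - d * u 0 1).
have v_foot t : line_of v (foot t).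
  by rewrite -E; apply/line_ofP; rewrite u2E /N /foot /=; ring.
have [/line_ofP + /line_ofP] := (v_foot 0, v_foot 1).
rewrite /foot /= => v_foot0 v_foot1.
have parallel : v 0 0 * u 0 1 = v 0 1 * u 0 0 by lra.
have v2E : v 0 2 = d * (u 0 0 * v 0 0 + u 0 1 * v 0 1) by lra.
have vE : v = ((u 0 0 * v 0 0 + u 0 1 * v 0 1) / N) *: u.
  apply: row3P; rewrite mxE; apply: (mulIf N0);
    rewrite mulrAC divfK // ?v2E ?u2E /N.
  - transitivity (u 0 0 ^+ 2 * v 0 0 + v 0 0 * u 0 1 * u 0 1); first by ring.
    by rewrite parallel; ring.
  - transitivity (u 0 1 ^+ 2 * v 0 1 + v 0 1 * u 0 0 * u 0 0); first by ring.
    by rewrite -parallel; ring.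
  - by ring.
exists ((u 0 0 * v 0 0 + u 0 1 * v 0 1) / N) => //.
apply/negP => /eqP s0; move: av.
by rewrite vE s0 scale0r /affine_coords !mxE eqxx; case.
Qed.

Lemma bracket_neq0 u v p :
  affine_coords u -> (line_of u `&` line_of v)%classic = [set p]%classic ->
  bracket u v != 0.
Proof.
move=> au uv; apply/eqP => b0.
have [/line_ofP pu /line_ofP pv] : (line_of u `&` line_of v)%classic p.
  by rewrite uv.
have : (line_of u `&` line_of v)%classic (p.1 - u 0 1, p.2 + u 0 0).
  split; apply/line_ofP => /=; first by rewrite -pu; ring.
  by rewrite -pv -[RHS]addr0 -b0 /bracket; ring.
rewrite uv /=; case: p {uv pu pv} => x y /= [e1 e0].
have u1 : u 0 1 = 0 by lra.
have u0 : u 0 0 = 0 by lra.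
by case: au; rewrite ?u1 ?u0 eqxx.
Qed.

Lemma intersectionE u v p :
  bracket u v != 0 -> line_of u p -> line_of v p ->
  p = (cross u v 0 0 / bracket u v, cross u v 0 1 / bracket u v).
Proof.
case: p => x y b0 /line_ofP /= xu /line_ofP /= xv; rewrite !row3E.
have ex : x * bracket u v = u 0 1 * v 0 2 - u 0 2 * v 0 1.
  have := congr1 (fun z => v 0 1 * z) xu.
  by have := congr1 (fun z => u 0 1 * z) xv; rewrite /bracket; lra.
have ey : y * bracket u v = u 0 2 * v 0 0 - u 0 0 * v 0 2.
  have := congr1 (fun z => v 0 0 * z) xu.
  by have := congr1 (fun z => u 0 0 * z) xv; rewrite /bracket; lra.
by rewrite -ex -ey !mulfK.
Qed.

Definition trilateral_area u v w : R :=
  det3 u v w ^+ 2 / (2 * `|bracket u v * bracket v w * bracket u w|).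

Lemma trilateral_area_swap12 u v w :
  trilateral_area v u w = trilateral_area u v w.
Proof.
rewrite /trilateral_area det3_swap12 sqrrN (bracketC u v) -normrN.
by congr (_ / (2 * `|_|)); ring.
Qed.

Lemma trilateral_area_swap23 u v w :
  trilateral_area u w v = trilateral_area u v w.
Proof.
rewrite /trilateral_area det3_swap23 sqrrN (bracketC v w) -normrN.
by congr (_ / (2 * `|_|)); ring.
Qed.

Lemma triangle_area_trilateral u v w (x : R) :
  affine_coords u -> affine_coords v ->
  triangle_area (line_of u) (line_of v) (line_of w) x ->
  [/\ bracket u v != 0, bracket v w != 0, bracket u w != 0 &
      x = trilateral_area u v w].
Proof.
move=> au av [p [q [r [vw uw uv ->]]]].
have buv := bracket_neq0 au uv.
have bvw := bracket_neq0 av vw.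
have buw := bracket_neq0 au uw.
split=> //.
have [pv pw] : (line_of v `&` line_of w)%classic p by rewrite vw.
have [qu qw] : (line_of u `&` line_of w)%classic q by rewrite uw.
have [ru rv] : (line_of u `&` line_of v)%classic r by rewrite uv.
rewrite (intersectionE bvw pv pw) (intersectionE buw qu qw).
rewrite (intersectionE buv ru rv).
rewrite /area /trilateral_area /= !row3E.
set signed_area := (X in `|X|).
have -> : signed_area =
    - (det3 u v w ^+ 2 / (bracket u v * bracket v w * bracket u w)).
  rewrite /signed_area det3E; move: buv bvw buw.
  rewrite /bracket => buv bvw buw.
  by field; rewrite buv bvw buw.
rewrite normrN normrM normfV (ger0_norm (sqr_ge0 _)) invfM; ring.
Qed.

End Triangles.

Section Hyperbolas.
Variable R : realType.
Implicit Types a b l X P : 'rV[R]_3.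

(* The conic [2 (a . X) (b . X) = k z^2] in homogeneous coordinates
   [X = (x : y : z)]; its asymptotes are [a] and [b]. *)
Definition hyperbola a b (k : R) : 'M[R]_3 :=
  a^T *m b + b^T *m a - k *: delta_mx 2 2.

Lemma hyperbolaC a b (k : R) : hyperbola a b k = hyperbola b a k.
Proof. by rewrite /hyperbola [b^T *m a + _]addrC. Qed.

Lemma hyperbola_entry a b (k : R) (i j : 'I_3) :
  hyperbola a b k i j =
    a 0 i * b 0 j + b 0 i * a 0 j - k * ((i == 2) && (j == 2))%:R.
Proof. by rewrite !mxE !big_ord1 !mxE. Qed.

Lemma hyperbola_form a b (k : R) X P :
  (X *m hyperbola a b k *m P^T) 0 0 =
    dot3 X a * dot3 b P + dot3 X b * dot3 a P - k * X 0 2 * P 0 2.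
Proof.
by rewrite mxE sum_ord3 !mxE !sum_ord3 !hyperbola_entry /= /dot3; ring.
Qed.

Lemma hyperbola_conic a b (k : R) :
  bracket a b != 0 -> is_conic (hyperbola a b k).
Proof.
move=> ab; split.
  by apply/matrixP => i j; rewrite mxE !hyperbola_entry andbC; ring.
pose A : 'M[R]_(2, 3) := pid_mx 2.
have rank2 : \rank (A *m hyperbola a b k *m A^T) = 2%N.
  apply: mxrank_unit; rewrite unitmxE unitfE (expand_det_row _ 0).
  rewrite !big_ord_recl big_ord0 /cofactor !det_mx11 !mxE !sum_ord3 !mxE.
  rewrite !sum_ord3 !hyperbola_entry !mxE /=.
  have : - bracket a b ^+ 2 != 0 by rewrite oppr_eq0 sqrf_eq0.
  by congr (_ != 0); rewrite /bracket /=; ring.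
apply: leq_trans (mxrankM_maxr A _); apply: leq_trans (mxrankM_maxl _ A^T).
by rewrite rank2.
Qed.

Lemma tangent_asymptote a b (k : R) :
  affine_coords a -> tangent (hyperbola a b k) (line_of a).
Proof.
move=> aa; exists a, (row3 (a 0 1) (- a 0 0) 0); split => //.
- apply/eqP => /rowP P0; have := P0 0; have := P0 1.
  rewrite !row3E !mxE => /eqP.
  by rewrite oppr_eq0 => /eqP a0 a1; case: aa; rewrite ?a0 ?a1 eqxx.
- by apply/incidentP; rewrite /dot3 !row3E; ring.
- move=> X /incidentP Xa; apply/matrixP => i j.
  by rewrite !ord1 hyperbola_form Xa [RHS]mxE /dot3 !row3E; ring.
Qed.

Definition touching_coef a b l : R :=
  - det3 a b l ^+ 2 / (2 * (bracket a l * bracket b l)).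

(* The contact point is the midpoint of the intersections with the
   asymptotes. *)
Lemma tangent_hyperbola a b l :
  affine_coords l -> bracket a l != 0 -> bracket b l != 0 ->
  tangent (hyperbola a b (touching_coef a b l)) (line_of l).
Proof.
move=> ll al bl; pose P := bracket b l *: cross a l + bracket a l *: cross b l.
have P2 : P 0 2 = 2 * (bracket a l * bracket b l) by rewrite !mxE /=; ring.
have Pl : dot3 P l = 0 by rewrite /dot3 !mxE /= /bracket; ring.
have aP : dot3 a P = bracket a l * det3 a b l.
  by rewrite det3E /dot3 !mxE /= /bracket; ring.
have bP : dot3 b P = - bracket b l * det3 a b l.
  by rewrite det3E /dot3 !mxE /= /bracket; ring.
exists l, P; split => //; last move=> X /incidentP Xl.
- apply/eqP => /rowP/(_ 2)/eqP.
  by rewrite P2 mxE !mulf_eq0 pnatr_eq0 (negbTE al) (negbTE bl).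
- exact/incidentP.
have XE : dot3 X a * bracket b l - dot3 X b * bracket a l = det3 a b l * X 0 2.
  apply/eqP; rewrite -subr_eq0 -[X in _ == X](mulr0 (- bracket a b)) -Xl.
  by apply/eqP; rewrite det3E /dot3 /bracket; ring.
apply/matrixP => i j.
rewrite !ord1 hyperbola_form [RHS]mxE aP bP P2 /touching_coef.
transitivity (- det3 a b l *
   (dot3 X a * bracket b l - dot3 X b * bracket a l - det3 a b l * X 0 2)).
  by field; rewrite al bl.
by rewrite XE subrr mulr0.
Qed.

(* The side of the pair on which the direction of the third line lies decides
   which of the two conjugate hyperbolas it touches. *)
Lemma touching_coefE a b l :
  bracket a b != 0 -> bracket a l != 0 -> bracket b l != 0 ->
  touching_coef a b l =
  - Num.sg (bracket a l * bracket b l) * trilateral_area a b l * `|bracket a b|.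
Proof.
rewrite -(normr_eq0 (bracket a b)) => ab al bl.
rewrite /touching_coef /trilateral_area.
rewrite -[bracket a b * _ * _]mulrA [bracket b l * _]mulrC normrM.
have : bracket a l * bracket b l != 0 by rewrite mulf_neq0.
move: (_ * bracket b l) => d; case: (ltrgt0P d) => // d_sgn.
  by rewrite gtr0_sg // => _; field; rewrite ab lt0r_neq0.
by rewrite ltr0_sg // => _; field; rewrite ab ltr0_neq0.
Qed.

Lemma card_tangent_le5 (n : nat) (L : 'I_n -> set (R * R)) (Q : 'M[R]_3) :
  no_six_cotangent L -> is_conic Q ->
  (#|[set i | `[< tangent Q (L i) >]]| <= 5)%N.
Proof.
move=> no6 conicQ; rewrite leqNgt; apply/negP => /exists_subset_card[S tanS S6].
apply: (no6 S S6); exists Q => // i /(subsetP tanS).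
by rewrite inE => /asboolP.
Qed.

End Hyperbolas.

Section SlopeOrder.
Variable R : realType.
Implicit Types u v w : 'rV[R]_3.

Definition upper u : bool := (0 < u 0 0) || (u 0 0 == 0) && (0 < u 0 1).

Lemma bracket_upper_trans u v w :
  upper u -> upper v -> upper w ->
  0 <= bracket u v -> 0 <= bracket v w -> 0 <= bracket u w.
Proof.
have upper_ge0 x : upper x -> 0 <= x 0 0.
  by case/orP=> [/ltW|/andP[/eqP ->]].
move=> /upper_ge0 u0 Uv /[dup] Uw /upper_ge0 w0 uv vw.
case/orP: Uv => [v0|/andP[/eqP v0 v1]].
  rewrite -(pmulr_rge0 _ v0).
  have -> : v 0 0 * bracket u w = u 0 0 * bracket v w + w 0 0 * bracket u v.
    by rewrite /bracket; ring.
  by rewrite addr_ge0 ?mulr_ge0.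
have w00 : w 0 0 = 0.
  by apply/eqP; rewrite eq_le w0; move: vw; rewrite /bracket v0; nra.
case/orP: Uw; rewrite /bracket w00 ?ltxx // eqxx => /ltW w1.
by rewrite mulr0 subr0 mulr_ge0.
Qed.

Lemma upper_line (l : set (R * R)) :
  is_line l -> exists u, [/\ upper u, affine_coords u & l = line_of u].
Proof.
move=> [u au ->]; have [U|U] := boolP (upper u); first by exists u.
exists (- u); split; last first.
- apply/seteqP; split=> p /line_ofP pu; apply/line_ofP;
    by move: pu; rewrite !mxE; lra.
- by rewrite /affine_coords !mxE !oppr_eq0.
move: U au; rewrite /upper /affine_coords !mxE oppr_eq0 !oppr_gt0.
by case: (ltrgt0P (u 0 0)) => //= _; case: (ltrgt0P (u 0 1)) => //= _ _ [].
Qed.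

End SlopeOrder.

Section SameArea.
Variables (R : realType) (n : nat) (u : 'I_n -> 'rV[R]_3).
Implicit Types (a b c l : 'I_n) (S T P : {set 'I_n}) (x : R).

Definition has_area T x : Prop :=
  exists i j k, [/\ T = [set i; j; k], bracket (u i) (u j) != 0,
    bracket (u j) (u k) != 0, bracket (u i) (u k) != 0 &
    x = trilateral_area (u i) (u j) (u k)].

Lemma bracket_neq0_neq a b : bracket (u a) (u b) != 0 -> a != b.
Proof. by apply: contraNneq => ->; rewrite bracketxx. Qed.

Lemma card_has_area T x : has_area T x -> #|T| = 3%N.
Proof.
move=> [i [j [k [-> ij jk ik _]]]]; apply/eqP/cards3P.
by split; apply: bracket_neq0_neq.
Qed.

Lemma has_area_set3 a b c x :
  has_area [set a; b; c] x ->
  [/\ bracket (u a) (u b) != 0, bracket (u b) (u c) != 0,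
      bracket (u a) (u c) != 0 & x = trilateral_area (u a) (u b) (u c)].
Proof.
move=> abc_area; have /eqP/cards3P[ab ac bc] := card_has_area abc_area.
case: abc_area => i [j [k [E ij jk ik ->]]].
have sym p q : bracket (u p) (u q) != 0 -> bracket (u q) (u p) != 0.
  by rewrite (bracketC (u p)) oppr_eq0.
have [ji kj ki] := And3 (sym _ _ ij) (sym _ _ jk) (sym _ _ ik).
have [swap12 swap23] := (@trilateral_area_swap12 R, @trilateral_area_swap23 R).
have : [&& a \in [set i; j; k], b \in [set i; j; k] & c \in [set i; j; k]].
  by rewrite -E !inE !eqxx !orbT.
rewrite !inE -!orbA => /and3P[/or3P[]/eqP ea /or3P[]/eqP eb /or3P[]/eqP ec];
  move: ab ac bc; rewrite ea eb ec ?eqxx // => _ _ _; split=> //.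
- by rewrite -swap12 -swap23.
- by rewrite -swap23 -swap12.
- by rewrite -swap12 -swap23 -swap12.
Qed.

Lemma has_area_inj T x y : has_area T x -> has_area T y -> x = y.
Proof.
by move=> Tx [i [j [k [E _ _ _ ->]]]]; move: Tx; rewrite E => /has_area_set3[].
Qed.

Definition same_area : rel {set 'I_n} :=
  fun T T' => (T != T') && `[< exists2 x, has_area T x & has_area T' x >].

Lemma same_area_sym : symmetric same_area.
Proof.
move=> T T'; rewrite /same_area eq_sym; congr (_ && _).
by apply/asboolP/asboolP => -[x]; exists x.
Qed.

Lemma same_area_irr : irreflexive same_area.
Proof. by move=> T; rewrite /same_area eqxx. Qed.

Lemma card_same_area T T' : same_area T T' -> #|T'| = 3%N.
Proof. by case/andP=> _ /asboolP[x _ /card_has_area]. Qed.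

Hypothesis u_affine : forall i, affine_coords (u i).

Lemma distinct_areas_of_independent S :
  independent same_area S -> distinct_areas (fun i => line_of (u i)) S.
Proof.
move=> indS i j k i' j' k' x x' iS jS kS iS' jS' kS'.
move=> /(triangle_area_trilateral (u_affine i) (u_affine j))[ij jk ik ->].
move=> /(triangle_area_trilateral (u_affine i') (u_affine j'))[ij' jk' ik' ->].
move=> neq.
have sub p q r : p \in S -> q \in S -> r \in S -> [set p; q; r] \subset S.
  by move=> pS qS rS; rewrite !subUset !sub1set pS qS.
apply/eqP => e; have same : same_area [set i; j; k] [set i'; j'; k'].
  apply/andP; split => //; apply/asboolP.
  exists (trilateral_area (u i) (u j) (u k)).
    by exists i, j, k.
  by exists i', j', k'.
by have := indS _ _ same; rewrite subUset !sub.
Qed.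

Hypothesis u_upper : forall i, upper (u i).

Definition slope_le : rel 'I_n := fun i j => 0 <= bracket (u i) (u j).

Lemma slope_le_total : total slope_le.
Proof. by move=> i j; rewrite /slope_le (bracketC (u i)) oppr_ge0 le_total. Qed.

Lemma slope_le_trans : transitive slope_le.
Proof. by move=> j i k; apply: bracket_upper_trans. Qed.

Lemma outer_slope_le a b l :
  bracket (u a) (u l) != 0 -> bracket (u b) (u l) != 0 ->
  outer slope_le [set a; b] l = (0 < bracket (u a) (u l) * bracket (u b) (u l)).
Proof.
move=> al bl; have outerE (r : rel 'I_n) :
    [forall i in [set a; b], r i l] = r a l && r b l.
  apply/forall_inP/andP => [r_l|[ra rb] i].
    by split; apply: r_l; rewrite !inE eqxx ?orbT.
  by rewrite !inE => /orP[] /eqP ->.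
rewrite /outer outerE (outerE (fun i j => slope_le j i)) /slope_le.
rewrite !(bracketC (u _) (u l)) !oppr_ge0.
move: (bracket (u a) _) (bracket (u b) _) al bl => y z.
case: (ltrgt0P y) => // y_sgn _.
  by rewrite (pmulr_rgt0 _ y_sgn); case: ltrgt0P.
by rewrite (nmulr_rgt0 _ y_sgn); case: ltrgt0P.
Qed.

Hypothesis no6 : no_six_cotangent (fun i => line_of (u i)).

Lemma card_same_area_link T P (side : bool) :
  #|P| = 2%N ->
  (#|[set l | same_area T (l |: P) && (outer slope_le P l == side)]| <= 3)%N.
Proof.
move=> /eqP/cards2P[a [b [ab ->]]]; set link := [set l | _].
have linkP l : l \in link -> exists x, [/\ has_area T x,
    has_area [set a; b; l] x & outer slope_le [set a; b] l = side].
  rewrite inE => /andP[/andP[_ /asboolP[x Tx lx]] /eqP outl].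
  by exists x; rewrite setUC.
have [->|[l0 /linkP[x [Tx /has_area_set3[bab _ _ _] _]]]] := set_0Vmem link.
  by rewrite cards0.
pose k := - (if side then 1 else -1) * x * `|bracket (u a) (u b)|.
have tanQ l : l \in [set a; b] :|: link ->
    tangent (hyperbola (u a) (u b) k) (line_of (u l)).
  case/setUP=> [/set2P[]->|/linkP[y [Ty /has_area_set3[_ bl al ey] outl]]].
  - exact: tangent_asymptote.
  - by rewrite hyperbolaC; apply: tangent_asymptote.
  have -> : k = touching_coef (u a) (u b) (u l); last exact: tangent_hyperbola.
  rewrite touching_coefE // -ey (has_area_inj Ty Tx) /k -outl outer_slope_le //.
  move: (mulf_neq0 al bl); move: (_ * bracket (u b) (u l)) => d.
  by case: ltrgt0P => // [/gtr0_sg|/ltr0_sg] ->.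
have link_new l : l \in link -> l \notin [set a; b].
  rewrite inE => /andP[/card_same_area + _].
  by rewrite cardsU1 cards2 ab; case: (l \in _).
have disj : [disjoint [set a; b] & link].
  by rewrite disjoint_sym disjoint_subset; apply/subsetP => l /link_new.
have : (#|[set a; b] :|: link| <= 5)%N.
  apply: leq_trans (card_tangent_le5 no6 (hyperbola_conic k bab)).
  by apply/subset_leq_card/subsetP => l /tanQ tan_l; rewrite inE; apply/asboolP.
by rewrite cardsU disjoint_setI0 // cards0 subn0 cards2 ab.
Qed.

Lemma exists_independent_same_area (N : nat) :
  (N < n)%N -> (N ^ 5 <= n)%N ->
  exists2 S : {set 'I_n}, #|S| = N.+1 & independent same_area S.
Proof.
have := exists_independent_set slope_le_total slope_le_trans
  same_area_sym same_area_irr card_same_area card_same_area_link.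
by rewrite card_ord; apply.
Qed.

End SameArea.

Lemma guaranteed_root (R : realType) (n N : nat) :
  (N < n)%N -> (N ^ 5 <= n)%N -> guaranteed R n N.+1.
Proof.
move=> Nn N5n L [_ lines] no6.
have /choice[u uP] i :
    exists u, [/\ upper u, affine_coords u & L i = line_of u].
  exact: upper_line.
have u_upper i : upper (u i) by case: (uP i).
have u_affine i : affine_coords (u i) by case: (uP i).
have eL : L = fun i => line_of (u i) by apply/funext => i; case: (uP i).
rewrite eL in no6 *.
have [S cS indS] := exists_independent_same_area u_affine u_upper no6 Nn N5n.
by exists S; split=> //; exact: distinct_areas_of_independent.
Qed.

Section DualConics.

Lemma root_sum_eq0 (F : fieldType) (p : {poly F}) (rs : seq F) :
  p != 0 -> (size p <= (size rs).+1)%N -> p`_(size rs).-1 = 0 ->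
  rs != [::] -> uniq rs -> all (root p) rs -> \sum_(x <- rs) x = 0.
Proof.
move=> p0 size_p p_subdeg rs0 rs_uniq rs_roots.
have size_pE : size p = (size rs).+1.
  by apply/eqP; rewrite eqn_leq size_p max_poly_roots.
have pE : p = lead_coef p *: \prod_(x <- rs) ('X - x%:P).
  by apply: all_roots_prod_XsubC; rewrite ?uniq_rootsE.
have lead0 : lead_coef p != 0 by rewrite lead_coef_eq0.
apply/eqP; rewrite -oppr_eq0 -(inj_eq (mulfI lead0)).
by rewrite mulr0 -coefPn_prod_XsubC ?size_eq0 // -coefZ -pE p_subdeg.
Qed.

(* If [P Q = s u] with [s != 0] the dual conic vanishes at [u] because
   [Q \adj Q] is scalar; if [P Q = 0] then the rows of [\adj Q] lie in the
   kernel of [Q], which is the line through [P]. *)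
Lemma dual_conic_contact (F : fieldType) (n : nat) (Q : 'M[F]_n.+1)
    (P u : 'rV[F]_n.+1) (s : F) :
  (n <= \rank Q)%N -> P != 0 -> P *m u^T = 0 -> P *m Q = s *: u ->
  u *m \adj Q *m u^T = 0.
Proof.
move=> rankQ P0 Pu PQ; have [s0|s_neq0] := eqVneq s 0; last first.
  have -> : u = s^-1 *: (P *m Q) by rewrite PQ scalerA mulVf ?scale1r.
  rewrite -!scalemxAl -(mulmxA P) mul_mx_adj mul_mx_scalar -scalemxAl.
  by rewrite PQ !linearZ /= Pu !scaler0.
rewrite s0 scale0r in PQ.
have detQ : \det Q = 0.
  apply/eqP; apply: contraNT P0 => detQ; apply/eqP.
  by rewrite -(mulmxK (_ : Q \in unitmx) P) ?unitmxE ?unitfE // PQ mul0mx.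
have adjP : (\adj Q <= P)%MS.
  have PK : (P <= kermx Q)%MS by apply/sub_kermxP.
  have -> : (\adj Q <= P)%MS = (\adj Q <= kermx Q)%MS.
    apply/idP/idP => [/submx_trans|adjK]; first exact.
    apply: submx_trans adjK _; rewrite -(geq_leqif (mxrank_leqif_sup PK)).
    by rewrite mxrank_ker rank_rV P0 leq_subLR addn1.
  by apply/sub_kermxP; rewrite mul_adj_mx detQ raddf0.
have [D ->] := submxP adjP.
by rewrite -!mulmxA Pu !mulmx0.
Qed.

Lemma minors0_rank_le1 (F : fieldType) (m n : nat) (A : 'M[F]_(m, n)) :
  (forall i j k l, A i k * A j l = A i l * A j k) -> (\rank A <= 1)%N.
Proof.
move=> minors0; have [->|/matrix0Pn[i [k Aik]]] := eqVneq A 0.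
  by rewrite mxrank0.
have -> : A = (A i k)^-1 *: (col k A *m row i A).
  apply/matrixP => j l; rewrite !mxE big_ord1 !mxE; apply: (mulfI Aik).
  by rewrite mulVKf // minors0 mulrC.
apply: leq_trans (mxrank_scale _ _) _; apply: leq_trans (mxrankM_maxr _ _) _.
exact: rank_leq_row.
Qed.

Lemma adj_mx3E (F : comNzRingType) (Q : 'M[F]_3) (i j : 'I_3) :
  (\adj Q) i j = (-1) ^+ (j + i) *
    (Q (lift j 0) (lift i 0) * Q (lift j 1) (lift i 1) -
     Q (lift j 0) (lift i 1) * Q (lift j 1) (lift i 0)).
Proof.
rewrite mxE /cofactor (expand_det_row _ 0) !big_ord_recl big_ord0 /cofactor.
rewrite !det_mx11 !mxE.
have [-> ->] : lift 0 0 = 1 :> 'I_2 /\ lift 1 0 = 0 :> 'I_2.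
  by split; apply/val_inj.
by rewrite addr0 /= expr0 expr1 mul1r mulN1r mulrN.
Qed.

Lemma adj_mx3_neq0 (F : fieldType) (Q : 'M[F]_3) :
  (2 <= \rank Q)%N -> \adj Q != 0.
Proof.
apply: contraTneq => adj0; rewrite -ltnNge; apply: minors0_rank_le1 => i j k l.
have minor (a b : 'I_3) :
    Q (lift a 0) (lift b 0) * Q (lift a 1) (lift b 1) =
    Q (lift a 0) (lift b 1) * Q (lift a 1) (lift b 0).
  apply/eqP; rewrite -subr_eq0 -(mulrI_eq0 _ (@lreg_sign F (a + b))).
  by rewrite -adj_mx3E adj0 mxE.
have [->|/ord3_pairP[a ij]] := eqVneq i j; first by rewrite mulrC.
have [->//|/ord3_pairP[b kl]] := eqVneq k l.
case: ij kl => -[-> ->] [] [-> ->]; rewrite ?minor //.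
  by rewrite mulrC -minor mulrC.
by rewrite mulrC minor mulrC.
Qed.

Variable R : realType.
Implicit Types (A Q : 'M[R]_3) (u : 'rV[R]_3) (t : R).

Lemma tangent_dual Q u :
  is_conic Q -> affine_coords u -> tangent Q (line_of u) ->
  u *m \adj Q *m u^T = 0.
Proof.
move=> [symQ rankQ] au [v [P [av E P0 Pv tan]]].
have [s s0 vE] := line_of_inj au av E.
suff dual_v : v *m \adj Q *m v^T = 0.
  apply: (scalerI s0); apply: (scalerI s0); rewrite !scaler0 -dual_v vE.
  by rewrite [(s *: u)^T]linearZ /= -scalemxAr -!scalemxAl.
have /sub_rVP[r PQ] : (P *m Q <= v)%MS.
  rewrite submxE; move: (cokermx v) (mulmx_coker v) => C vC.
  apply/eqP/trmx_inj/row_matrixP => i.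
  rewrite trmx0 row0 !trmx_mul symQ mulmxA !row_mul.
  by apply: tan; rewrite /incident -row_mul -trmx_mul vC trmx0 row0.
exact: dual_conic_contact rankQ P0 Pv PQ.
Qed.

Definition cubic_line t : 'rV[R]_3 := row3 1 t (t ^+ 3).

Lemma cubic_line_affine t : affine_coords (cubic_line t).
Proof. by left; rewrite row3E oner_neq0. Qed.

Definition cubic_form A : {poly R} :=
  Poly [:: A 0 0; 2 * A 0 1; A 1 1; 2 * A 0 2; 2 * A 1 2; 0; A 2 2].

Lemma horner_cubic_form A t :
  A^T = A -> (cubic_form A).[t] = (cubic_line t *m A *m (cubic_line t)^T) 0 0.
Proof.
move=> symA; have sym i j : A j i = A i j by rewrite -{1}symA mxE.
rewrite horner_Poly /= mul_row_trE /dot3 !mxE !sum_ord3 !row3E.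
by rewrite (sym 0 1) (sym 0 2) (sym 1 2) /=; ring.
Qed.

Lemma cubic_form_eq0 A : A^T = A -> cubic_form A = 0 -> A = 0.
Proof.
move=> symA A0; have sym i j : A j i = A i j by rewrite -{1}symA mxE.
have coef i : (cubic_form A)`_i = 0 by rewrite A0 coef0.
have := (coef 0, coef 1, coef 2, coef 3, coef 4, coef 6).
rewrite /cubic_form !coef_Poly /= => -[[[[[A00 A01] A11] A02] A12] A22].
apply/matrixP => i j; rewrite mxE.
by case: (ord3P i) => ->; case: (ord3P j) => ->;
  rewrite ?(sym 0 1) ?(sym 0 2) ?(sym 1 2); lra.
Qed.

Definition cubic_arrangement (n : nat) (i : 'I_n) : set (R * R) :=
  line_of (cubic_line i.+1%:R).

Lemma line_arrangement_cubic (n : nat) :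
  line_arrangement (@cubic_arrangement n).
Proof.
split=> [i j|i]; last first.
  by exists (cubic_line i.+1%:R) => //; exact: cubic_line_affine.
case/line_of_inj => [||s _]; try exact: cubic_line_affine.
move=> /rowP vE; have := vE 0; have := vE 1; rewrite !mxE /= mulr1 => + s1.
by rewrite -s1 mul1r => /eqP; rewrite eqr_nat => /eqP[ji]; apply/val_inj.
Qed.

Lemma no_six_cotangent_cubic (n : nat) :
  no_six_cotangent (@cubic_arrangement n).
Proof.
move=> S S6 [Q conicQ tanQ]; have [symQ rankQ] := conicQ.
have sym_adj : (\adj Q)^T = \adj Q by rewrite trmx_adj symQ.
pose ts : seq R := [seq i.+1%:R | i : 'I_n <- enum S].
have size_ts : size ts = 6%N by rewrite size_map -cardE.
have ts_gt0 t : t \in ts -> 0 < t by case/mapP=> i _ ->; rewrite ltr0n.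
have ts_uniq : uniq ts.
  rewrite map_inj_uniq ?enum_uniq // => i j /eqP; rewrite eqr_nat => /eqP[ij].
  exact/val_inj.
have ts_roots : all (root (cubic_form (\adj Q))) ts.
  apply/allP => _ /mapP[i + ->]; rewrite mem_enum => iS; apply/rootP.
  rewrite horner_cubic_form //.
  by rewrite (tangent_dual conicQ (cubic_line_affine _) (tanQ i iS)) mxE.
have form_neq0 : cubic_form (\adj Q) != 0.
  by apply: contraNneq (adj_mx3_neq0 rankQ) => /cubic_form_eq0 ->.
have : \sum_(t <- ts) t = 0.
  apply: root_sum_eq0 form_neq0 _ _ _ ts_uniq ts_roots.
  - by rewrite size_ts size_Poly.
  - by rewrite size_ts coef_Poly.
  - by rewrite -size_eq0 size_ts.
case: ts size_ts ts_gt0 {ts_uniq ts_roots} => // t ts _ ts_gt0.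
apply/eqP/lt0r_neq0.
rewrite big_cons ltr_pwDl ?ts_gt0 ?mem_head // big_seq sumr_ge0 // => t' t'ts.
by rewrite ltW // ts_gt0 // inE t'ts orbT.
Qed.

End DualConics.

Section LargestGuaranteed.
Variables (R : realType) (n : nat).

Lemma guaranteed_le (d : nat) : guaranteed R n d -> (d <= n)%N.
Proof.
move=> /(_ _ (line_arrangement_cubic R n) (@no_six_cotangent_cubic R n)).
move=> [S [<- _]].
by rewrite -[leqRHS]card_ord max_card.
Qed.

Lemma guaranteed_le_D (d : nat) : guaranteed R n d -> (d <= D R n)%N.
Proof.
move=> gd; pose g d' := `[< guaranteed R n d' >].
have ex_g : exists d', g d' by exists d; apply/asboolP.
have g_le d' : g d' -> (d' <= n)%N by move=> /asboolP/guaranteed_le.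
case: (ex_maxnP ex_g g_le) => m /asboolP gm m_max.
suff [_ D_max] : is_largest (guaranteed R n) (D R n) by exact: D_max.
apply: (@xgetPex _ 0%N (is_largest (guaranteed R n))).
by exists m; split=> // d' gd'; apply/m_max/asboolP.
Qed.

End LargestGuaranteed.

Lemma ltn_of_exp_le (N n k : nat) :
  (2 <= n)%N -> (2 <= k)%N -> (N ^ k <= n)%N -> (N < n)%N.
Proof.
move=> n2 k2; have [N1 _|N2] := leqP N 1; first exact: leq_ltn_trans N1 n2.
by apply: leq_trans; rewrite -{1}(expn1 N) ltn_exp2l.
Qed.

Theorem theorem4 (R : realType) (n : nat) (hn : (2 <= n)%N) :
  (n%:R : R) `^ (5%:R^-1) < (D R n)%:R.
Proof.
set x := _ `^ _; pose N := Num.truncn x.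
have x5 : x ^+ 5 = n%:R.
  by rewrite -powR_mulrn ?powR_ge0 // -powRrM mulVf ?pnatr_eq0 // powRr1.
have /andP[N_le_x x_lt_N1] : N%:R <= x < N.+1%:R.
  by rewrite truncn_itv ?powR_ge0.
have N5n : (N ^ 5 <= n)%N.
  by rewrite -(ler_nat R) natrX -x5 lerXn2r ?nnegrE ?powR_ge0.
have Nn := ltn_of_exp_le hn (isT : 2 <= 5)%N N5n.
apply: lt_le_trans x_lt_N1 _; rewrite ler_nat.
exact: guaranteed_le_D (guaranteed_root Nn N5n).
Qed.
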